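(* Let $n\ge 2$ be an integer, let $x_1\le\cdots\le x_n$ be real numbers that are not all equal, and let $y_1\le\cdots\le y_n$ be real numbers that are not all equal. Put $\bar{x}=\frac1n\sum_{i=1}^n x_i$ and $\bar{y}=\frac1n\sum_{i=1}^n y_i$. Then $$\frac{1}{n}\;\le\;\frac{\sum_{i=1}^n(x_i-\bar{x})(y_i-\bar{y})}{(x_n-x_1)(y_n-y_1)}\;\le\;\begin{cases}\dfrac{n}{4}, & \text{if } n \text{ is even},\\[2mm] \dfrac{n^2-1}{4n}, & \text{if } n \text{ is odd}.\end{cases}$$ Moreover: (a) The upper bound is achieved (i.e. the right-hand inequality is an equality) in the following cases: (i) $n=2m$ with $m\ge 1$, $x_1=\cdots=x_m<x_{m+1}=\cdots=x_n$ and $y_1=\cdots=y_m<y_{m+1}=\cdots=y_n$; (ii) $n=2m+1$ with $m\ge 1$, and either [$x_1=\cdots=x_m<x_{m+1}=\cdots=x_n$ and $y_1=\cdots=y_m<y_{m+1}=\cdots=y_n$] or [$x_1=\cdots=x_{m+1}<x_{m+2}=\cdots=x_n$ and $y_1=\cdots=y_{m+1}<y_{m+2}=\cdots=y_n$]. (b) The lower bound is achieved (i.e. the left-hand inequality is an equality) when either [$x_1<x_2=\cdots=x_n$ and $y_1=y_2=\cdots=y_{n-1}<y_n$] or [$x_1=x_2=\cdots=x_{n-1}<x_n$ and $y_1<y_2=\cdots=y_n$]. *)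

(* Defs.v *)
From HB Require Import structures.
From mathcomp Require Import all_boot all_order all_algebra.

Set Implicit Arguments.
Unset Strict Implicit.
Unset Printing Implicit Defensive.

Import Order.TTheory GRing.Theory Num.Theory.
Local Open Scope ring_scope.

(* A family x_1, ..., x_n is a function on 'I_n, so x_i is [x] at the ordinal
   of value i - 1.  In particular x_1 and x_n are [x (ord_first hn)] and
   [x (ord_last hn)]. *)

Definition ord_first (n : nat) (hn : (1 < n)%N) : 'I_n := Ordinal (ltnW hn).

Lemma ord_last_subproof (n : nat) (hn : (1 < n)%N) : (n.-1 < n)%N.
Proof. by case: n hn. Qed.

Definition ord_last (n : nat) (hn : (1 < n)%N) : 'I_n :=
  Ordinal (ord_last_subproof hn).

Definition mean (R : realFieldType) (n : nat) (x : 'I_n -> R) : R :=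
  n%:R^-1 * \sum_(i < n) x i.

Definition cov_range_ratio (R : realFieldType) (n : nat) (hn : (1 < n)%N)
    (x y : 'I_n -> R) : R :=
  (\sum_(i < n) (x i - mean x) * (y i - mean y)) /
  ((x (ord_last hn) - x (ord_first hn)) * (y (ord_last hn) - y (ord_first hn))).

Definition upper_bound (R : realFieldType) (n : nat) : R :=
  if odd n then (n%:R ^+ 2 - 1) / (4 * n%:R) else n%:R / 4.

(* x_1 = ... = x_k < x_{k+1} = ... = x_n, for 1 <= k < n. *)
Definition jump_after (R : realFieldType) (n : nat) (k : nat)
    (x : 'I_n -> R) : Prop :=
  [/\ forall i j : 'I_n, (i < k)%N -> (j < k)%N -> x i = x j,
      forall i j : 'I_n, (i < k)%N -> (k <= j)%N -> x i < x j
    & forall i j : 'I_n, (k <= i)%N -> (k <= j)%N -> x i = x j].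

(* Main.v *)
Require Import Defs.
From HB Require Import structures.
From mathcomp Require Import all_boot all_order all_algebra.
From mathcomp Require Import zify ring.

(** The numerator of the ratio is a symmetric bilinear form in [x] and [y] that
    ignores additive constants.  A nondecreasing family is, up to a constant, a
    nonnegative combination of the step families [step k], [0 < k < n], which
    jump from 0 to 1 at position [k]: the weights are the consecutive increments,
    and they add up to the range [x_n - x_1] ([increment_decomposition],
    [sum_increment]).  Expanding both arguments ([cov_sum_expand]), the ratio
    becomes a weighted average of the numbers [cov_sum (step k) (step l)], which
    equal [min(k,l) (n - max(k,l)) / n] ([cov_sum_step]).

    So both inequalities reduce to integer ones.  With [a = min(k,l)] and
    [b = n - max(k,l)] one has [a, b >= 1] and [a + b <= n], hence [1 <= a b],
    and [4 a b <= n ^ 2] by the arithmetic-geometric inequality, with a loss of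
    at least 1 when [n] is odd because [4 a b] is even ([quarter_square_bound]).

    A family with a single jump is one step family up to a constant and a scale,
    so for two such families the ratio is exactly the number attached to the
    two jump positions ([cov_range_ratio_jump]); the equality cases are
    evaluations of that formula. *)

Set Implicit Arguments.
Unset Strict Implicit.
Unset Printing Implicit Defensive.

Import Order.TTheory GRing.Theory Num.Theory.
Local Open Scope ring_scope.

(** * The covariance form *)

Definition cov_sum (R : realFieldType) (n : nat) (x y : 'I_n -> R) : R :=
  \sum_(i < n) (x i - mean x) * (y i - mean y).

Lemma cov_sumC (R : realFieldType) (n : nat) (x y : 'I_n -> R) :
  cov_sum x y = cov_sum y x.
Proof. by apply: eq_bigr => i _; rewrite mulrC. Qed.

Lemma sum_deviation (R : realFieldType) (n : nat) (x : 'I_n -> R) :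
  (0 < n)%N -> \sum_(i < n) (x i - mean x) = 0.
Proof.
move=> n_gt0; rewrite sumrB sumr_const card_ord -[mean x *+ n]mulr_natl /mean mulrA.
by rewrite mulfV ?mul1r ?subrr // pnatr_eq0 -lt0n.
Qed.

(** Since the deviations of [x] add up to 0, the mean of [y] can be traded for
    any other constant. *)
Lemma cov_sum_shift (R : realFieldType) (n : nat) (x y : 'I_n -> R) (c : R) :
  (0 < n)%N -> cov_sum x y = \sum_(i < n) (x i - mean x) * (y i - c).
Proof.
move=> n_gt0; apply/eqP; rewrite -subr_eq0 -sumrB; apply/eqP.
rewrite (eq_bigr (fun i => (x i - mean x) * (c - mean y))); last first.
  by move=> i _; ring.
by rewrite -mulr_suml sum_deviation // mul0r.
Qed.

Lemma cov_sum_linear (R : realFieldType) (n m : nat) (x y : 'I_n -> R) (c : R)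
    (e : 'I_m -> R) (s : 'I_m -> 'I_n -> R) :
  (0 < n)%N -> (forall i, y i - c = \sum_(k < m) e k * s k i) ->
  cov_sum x y = \sum_(k < m) e k * cov_sum x (s k).
Proof.
move=> n_gt0 y_comb; rewrite (@cov_sum_shift _ _ x y c) //.
under eq_bigr => i _ do rewrite y_comb mulr_sumr.
rewrite exchange_big; apply: eq_bigr => k _ /=.
rewrite (@cov_sum_shift _ _ x (s k) 0) // mulr_sumr; apply: eq_bigr => i _.
by rewrite subr0 mulrCA.
Qed.

(** * Step families *)

Definition step (R : realFieldType) (n k : nat) (i : 'I_n) : R := (k <= i)%N%:R.

Arguments step : clear implicits.

Lemma sum_step (R : realFieldType) (n k : nat) :
  \sum_(i < n) step R n k i = (n - k)%:R.
Proof.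
rewrite /step -natr_sum; congr (_%:R).
rewrite -(big_mkord xpredT (fun i => nat_of_bool (k <= i)%N)).
elim: n => [|n IHn]; first by rewrite big_geq.
by rewrite big_nat_recr //= IHn; case: (leqP k n) => ?; lia.
Qed.

Lemma cov_sum_step (R : realFieldType) (n k l : nat) :
  (0 < n)%N -> (k <= n)%N -> (l <= n)%N ->
  cov_sum (step R n k) (step R n l) = (minn k l * (n - maxn k l))%:R / n%:R.
Proof.
move=> n_gt0; wlog le_kl: k l / (k <= l)%N => [IH k_le l_le | k_le l_le].
  have /orP[le_kl | /IH IHlk] := leq_total k l; first exact: IH.
  by rewrite cov_sumC IHlk // minnC maxnC.
have n_neq0 : n%:R != 0 :> R by rewrite pnatr_eq0 -lt0n.
rewrite (@cov_sum_shift _ _ _ _ 0) // (minn_idPl le_kl) (maxn_idPr le_kl).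
(* On the support of [step l] the family [step k] is constantly 1. *)
rewrite (eq_bigr (fun i => (1 - mean (step R n k)) * step R n l i)); last first.
  move=> i _; rewrite subr0 /step.
  by case: (leqP l i) => [le_li | _]; rewrite ?mulr0 // (leq_trans le_kl le_li).
rewrite -mulr_sumr sum_step /mean sum_step natrM !natrB //; field.
exact: n_neq0.
Qed.

(** * Decomposition of a family into steps *)

(** [insubd] extends the family to all of [nat], so that the increments
    telescope without any casts between ordinal types. *)
Definition increment (R : realFieldType) (n : nat) (hn : (1 < n)%N)
    (x : 'I_n -> R) (k : nat) : R :=
  x (insubd (ord_first hn) k.+1) - x (insubd (ord_first hn) k).

Lemma increment_decomposition (R : realFieldType) (n : nat) (hn : (1 < n)%N)
    (x : 'I_n -> R) (i : 'I_n) :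
  x i - x (ord_first hn) =
  \sum_(k < n.-1) increment hn x k * step R n k.+1 i.
Proof.
pose f k := increment hn x k.
have -> : \sum_(k < n.-1) increment hn x k * step R n k.+1 i
        = \sum_(k < n.-1 | (k < i)%N) f k.
  rewrite [RHS]big_mkcond; apply: eq_bigr => k _; rewrite /step /f.
  by case: ifP => _; rewrite ?mulr1 ?mulr0.
rewrite -(big_mkord (fun k => (k < i)%N) f) -(big_nat_widen _ _ _ xpredT); last first.
  by have := ltn_ord i; lia.
rewrite /f /increment telescope_sumr // valKd; congr (_ - x _).
by apply: val_inj; rewrite val_insubd; case: ifP.
Qed.

Lemma sum_increment (R : realFieldType) (n : nat) (hn : (1 < n)%N)
    (x : 'I_n -> R) :
  \sum_(k < n.-1) increment hn x k = x (ord_last hn) - x (ord_first hn).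
Proof.
rewrite increment_decomposition; apply: eq_bigr => k _.
by rewrite /step /= ltn_ord mulr1.
Qed.

Lemma increment_ge0 (R : realFieldType) (n : nat) (hn : (1 < n)%N)
    (x : 'I_n -> R) (k : 'I_n.-1) :
  (forall i j : 'I_n, (i <= j)%N -> x i <= x j) -> 0 <= increment hn x k.
Proof.
move=> x_mono; rewrite subr_ge0; apply: x_mono.
have k1_lt : (k.+1 < n)%N by have := ltn_ord k; lia.
by rewrite !val_insubd k1_lt (ltnW k1_lt) leqnSn.
Qed.

Lemma range_gt0 (R : realFieldType) (n : nat) (hn : (1 < n)%N) (x : 'I_n -> R) :
  (forall i j : 'I_n, (i <= j)%N -> x i <= x j) ->
  ~ (forall i j : 'I_n, x i = x j) ->
  0 < x (ord_last hn) - x (ord_first hn).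
Proof.
move=> x_mono x_nonconst; rewrite subr_gt0 ltNge; apply/negP => le_last_first.
suff x_first i : x i = x (ord_first hn).
  by apply: x_nonconst => i j; rewrite !x_first.
apply/eqP; rewrite eq_le (x_mono (ord_first hn) i) //= andbT; apply: le_trans le_last_first.
by apply: x_mono => /=; have := ltn_ord i; lia.
Qed.

Lemma cov_sum_expand (R : realFieldType) (n : nat) (hn : (1 < n)%N)
    (x y : 'I_n -> R) :
  cov_sum x y = \sum_(k < n.-1) \sum_(l < n.-1)
    increment hn x k * increment hn y l
      * cov_sum (step R n k.+1) (step R n l.+1).
Proof.
have n_gt0 : (0 < n)%N by exact: ltnW.
rewrite cov_sumC (cov_sum_linear _ n_gt0 (increment_decomposition hn x)).
apply: eq_bigr => k _; rewrite cov_sumC.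
rewrite (cov_sum_linear _ n_gt0 (increment_decomposition hn y)) mulr_sumr.
by apply: eq_bigr => l _; rewrite mulrA.
Qed.

(** * The two bounds *)

(** The parity correction comes for free: [4 a b] is even, so it cannot reach an
    odd [n ^ 2]. *)
Lemma quarter_square_bound (n a b : nat) :
  (a + b <= n)%N -> (4 * (a * b) + odd n <= n ^ 2)%N.
Proof.
move=> le_ab_n; have le_sq : (4 * (a * b) <= n ^ 2)%N.
  by apply: leq_trans (nat_AGM2 a b) _; rewrite leq_sqr.
case: (boolP (odd n)) => [odd_n | _]; last by rewrite addn0.
rewrite addn1 ltn_neqAle le_sq andbT; apply/eqP => /(congr1 odd).
by rewrite oddM oddX odd_n.
Qed.

Lemma upper_boundE (R : realFieldType) (n : nat) :
  (0 < n)%N -> upper_bound R n = (n%:R ^+ 2 - (odd n)%:R) / (4 * n%:R).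
Proof.
move=> n_gt0; rewrite /upper_bound; case: ifP => _ //=.
by field; rewrite pnatr_eq0 -lt0n.
Qed.

Lemma cov_sum_step_bounds (R : realFieldType) (n k l : nat) :
  (0 < k < n)%N -> (0 < l < n)%N ->
  1 / n%:R <= cov_sum (step R n k) (step R n l) <= upper_bound R n.
Proof.
move=> k_bd l_bd; have n_gt0 : (0 < n)%N by lia.
have n_pos : 0 < n%:R :> R by rewrite ltr0n.
rewrite cov_sum_step ?upper_boundE //; try lia.
have min_gt0 : (0 < minn k l)%N by lia.
have max_lt : (0 < n - maxn k l)%N by lia.
have : (minn k l + (n - maxn k l) <= n)%N by lia.
move/quarter_square_bound; move: min_gt0 max_lt.
move: (minn k l) (n - maxn k l)%N => a b a_gt0 b_gt0 le_sq.
rewrite ler_pM2r ?invr_gt0 // ler1n muln_gt0 a_gt0 b_gt0 /=.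
rewrite invfM mulrA ler_pM2r ?invr_gt0 // ler_pdivlMr ?ltr0n //.
by rewrite lerBrDr -natrX -natrM -natrD ler_nat mulnC.
Qed.

(** Nonnegative weights turn bounds on the step families into bounds on all
    monotone families. *)
Lemma cov_range_ratio_bounds (R : realFieldType) (n : nat) (hn : (1 < n)%N)
    (x y : 'I_n -> R) :
  (forall i j : 'I_n, (i <= j)%N -> x i <= x j) ->
  ~ (forall i j : 'I_n, x i = x j) ->
  (forall i j : 'I_n, (i <= j)%N -> y i <= y j) ->
  ~ (forall i j : 'I_n, y i = y j) ->
  1 / n%:R <= cov_range_ratio hn x y <= upper_bound R n.
Proof.
move=> x_mono x_nonconst y_mono y_nonconst.
have ranges_gt0 := mulr_gt0 (range_gt0 hn x_mono x_nonconst)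
                            (range_gt0 hn y_mono y_nonconst).
rewrite /cov_range_ratio -/(cov_sum x y).
rewrite ler_pdivlMr // ler_pdivrMr // -!sum_increment mulr_suml !mulr_sumr.
rewrite (cov_sum_expand hn).
have bounds (k l : 'I_n.-1) := @cov_sum_step_bounds R n k.+1 l.+1.
have S_bd (k : 'I_n.-1) : (0 < k.+1 < n)%N by have := ltn_ord k; lia.
have weight_ge0 (k l : 'I_n.-1) : 0 <= increment hn x k * increment hn y l.
  by rewrite mulr_ge0 ?increment_ge0.
apply/andP; split; apply: ler_sum => k _; rewrite !mulr_sumr;
  apply: ler_sum => l _; rewrite [_ * (increment _ _ _ * _)]mulrC ler_wpM2l //;
  by case/andP: (bounds k l (S_bd k) (S_bd l)).
Qed.

(** * Families with a single jump *)

Lemma jump_after_step (R : realFieldType) (n : nat) (hn : (1 < n)%N) (k : nat)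
    (x : 'I_n -> R) (i : 'I_n) :
  (0 < k < n)%N -> jump_after k x ->
  x i - x (ord_first hn) =
  (x (ord_last hn) - x (ord_first hn)) * step R n k i.
Proof.
move=> k_bd [x_low _ x_high]; rewrite /step.
case: (leqP k i) => [le_ki | lt_ik]; rewrite ?mulr1 ?mulr0.
  by congr (_ - _); apply: x_high => //=; lia.
by rewrite (x_low i (ord_first hn)) ?subrr //=; lia.
Qed.

Lemma cov_range_ratio_jump (R : realFieldType) (n : nat) (hn : (1 < n)%N)
    (k l : nat) (x y : 'I_n -> R) :
  (0 < k < n)%N -> (0 < l < n)%N -> jump_after k x -> jump_after l y ->
  cov_range_ratio hn x y = (minn k l * (n - maxn k l))%:R / n%:R.
Proof.
move=> k_bd l_bd x_jump y_jump; have n_gt0 : (0 < n)%N by lia.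
have range_neq0 h (z : 'I_n -> R) : (0 < h < n)%N -> jump_after h z ->
    z (ord_last hn) - z (ord_first hn) != 0.
  move=> h_bd [_ z_lt _]; rewrite gt_eqF // subr_gt0.
  by apply: z_lt => /=; lia.
have cov_step h (w z : 'I_n -> R) : (0 < h < n)%N -> jump_after h z ->
    cov_sum w z =
    (z (ord_last hn) - z (ord_first hn)) * cov_sum w (step R n h).
  move=> h_bd z_jump.
  rewrite (@cov_sum_linear _ n 1 w z (z (ord_first hn))
    (fun=> z (ord_last hn) - z (ord_first hn)) (fun=> step R n h)) ?big_ord1 //.
  by move=> i; rewrite big_ord1; apply: jump_after_step.
rewrite /cov_range_ratio -/(cov_sum x y) (cov_step l) // cov_sumC (cov_step k) //.
rewrite cov_sumC cov_sum_step; try lia.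
have n_neq0 : n%:R != 0 :> R by rewrite pnatr_eq0 -lt0n.
by field; rewrite (range_neq0 k x) // (range_neq0 l y) // n_neq0.
Qed.

(** The hypothesis on [k] is the equality case of [quarter_square_bound]: [k]
    and [n - k] differ by the parity of [n]. *)
Lemma cov_range_ratio_balanced_jump (R : realFieldType) (n : nat)
    (hn : (1 < n)%N) (k : nat) (x y : 'I_n -> R) :
  (0 < k < n)%N -> (4 * (k * (n - k)) + odd n = n ^ 2)%N ->
  jump_after k x -> jump_after k y -> cov_range_ratio hn x y = upper_bound R n.
Proof.
move=> k_bd sqE x_jump y_jump; have n_gt0 : (0 < n)%N by lia.
rewrite (cov_range_ratio_jump hn k_bd k_bd x_jump y_jump) minnn maxnn.
rewrite upper_boundE // -natrX -sqE natrD addrK [(4 * _)%:R]natrM.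
by rewrite -mulf_div mulfV ?mul1r // pnatr_eq0.
Qed.

Theorem theorem2p2 (R : realFieldType) (n : nat) (hn : (1 < n)%N)
    (x y : 'I_n -> R)
    (x_mono : forall i j : 'I_n, (i <= j)%N -> x i <= x j)
    (x_nonconst : ~ (forall i j : 'I_n, x i = x j))
    (y_mono : forall i j : 'I_n, (i <= j)%N -> y i <= y j)
    (y_nonconst : ~ (forall i j : 'I_n, y i = y j)) :
  (1 / n%:R <= cov_range_ratio hn x y /\
   cov_range_ratio hn x y <= upper_bound R n) /\
  ((forall m : nat, (1 <= m)%N -> n = (2 * m)%N ->
      jump_after m x /\ jump_after m y ->
      cov_range_ratio hn x y = upper_bound R n) /\
   (forall m : nat, (1 <= m)%N -> n = (2 * m + 1)%N ->
      (jump_after m x /\ jump_after m y) \/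
      (jump_after m.+1 x /\ jump_after m.+1 y) ->
      cov_range_ratio hn x y = upper_bound R n)) /\
  ((jump_after 1 x /\ jump_after n.-1 y) \/
   (jump_after n.-1 x /\ jump_after 1 y) ->
   cov_range_ratio hn x y = 1 / n%:R).
Proof.
split; first by apply/andP; exact: cov_range_ratio_bounds.
split; first split.
- move=> m m_gt0 nE [x_jump y_jump].
  apply: cov_range_ratio_balanced_jump x_jump y_jump; first by lia.
  have -> : odd n = false by lia.
  have -> : (n - m = m)%N by lia.
  by rewrite nE; nia.
- move=> m m_gt0 nE; have odd_n : odd n = true by lia.
  case=> -[x_jump y_jump];
    apply: cov_range_ratio_balanced_jump x_jump y_jump; rewrite ?odd_n.
  + by lia.
  + have -> : (n - m = m.+1)%N by lia.
    by rewrite nE; nia.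
  + by lia.
  + have -> : (n - m.+1 = m)%N by lia.
    by rewrite nE; nia.
- have prodE : (minn 1 n.-1 * (n - maxn 1 n.-1) = 1)%N.
    have -> : minn 1 n.-1 = 1%N by lia.
    by lia.
  case=> -[x_jump y_jump].
    by rewrite (cov_range_ratio_jump hn _ _ x_jump y_jump) ?prodE //; lia.
  rewrite (cov_range_ratio_jump hn _ _ x_jump y_jump); try lia.
  by rewrite minnC maxnC prodE.
Qed.
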